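(* Let $\mathcal{A}$ be a unital C$^*$-algebra, $\mathcal{A}_0\subset\mathcal{A}$ a dense $^*$-subalgebra, and let $\tau_0:\mathcal{A}_+\to[0,\infty]$ be a weight which is $\varepsilon$-invariant for $\delta$-unitaries of $\mathcal{A}_0$. Let $\tau$ be the semicontinuous regularization of $\tau_0$, i.e. $\tau(A)=\sup\{\psi(A):\psi\in\mathcal{A}^*_+,\ \psi\le\tau_0\}$ for $A\in\mathcal{A}_+$. Then $\tau$ is a trace on $\mathcal{A}$; namely, setting $\mathcal{J}_+:=\{A\in\mathcal{A}_+:\tau(A)<\infty\}$ and extending $\tau$ linearly to the linear span $\mathcal{J}$ of $\mathcal{J}_+$, one has: (i) $\mathcal{J}$ is an ideal in $\mathcal{A}$; (ii) $\tau(AB)=\tau(BA)$ for all $A\in\mathcal{J}$, $B\in\mathcal{A}$.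
   Context: A weight on a C$^*$-algebra $\mathcal{A}$ is a map $\tau_0:\mathcal{A}_+\to[0,\infty]$ with $\tau_0(\lambda A+B)=\lambda\tau_0(A)+\tau_0(B)$ for $\lambda>0$, $A,B\in\mathcal{A}_+$. $\mathcal{A}^*_+$ denotes the positive (bounded) linear functionals on $\mathcal{A}$, and $\psi\le\tau_0$ means $\psi(A)\le\tau_0(A)$ for all $A\in\mathcal{A}_+$. The functional $\tau$ defined by the supremum formula is a lower semicontinuous weight. For $\delta>0$, an element $U$ is called $\delta$-unitary if $\|U^*U-1\|<\delta$ and $\|UU^*-1\|<\delta$; $\mathcal{U}_\delta$ denotes the set of $\delta$-unitaries in $\mathcal{A}_0$. A weight $\tau_0$ is $\varepsilon$-invariant for $\delta$-unitaries of $\mathcal{A}_0$ if for every $\varepsilon\in(0,1)$ there is $\delta>0$ such that, for every $U\in\mathcal{U}_\delta$ and every $A\in\mathcal{A}_+$, $(1-\varepsilon)\tau_0(A)\le\tau_0(UAU^* )\le(1+\varepsilon)\tau_0(A)$. *)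

(* Defs.v *)
From HB Require Import structures.
From mathcomp Require Import all_boot all_order all_algebra.
From mathcomp Require Import complex.
From mathcomp Require Import all_classical all_reals all_analysis.

Set Implicit Arguments.
Unset Strict Implicit.
Unset Printing Implicit Defensive.

Import Order.TTheory GRing.Theory Num.Theory.

Local Open Scope classical_set_scope.
Local Open Scope ring_scope.
Local Open Scope complex_scope.

HB.mixin Record Algebra_isNormed (R : realType) A of GRing.Algebra R[i] A := {
  cnorm : A -> R;
  cnormD : forall x y : A, cnorm (x + y) <= cnorm x + cnorm y;
  cnormZ : forall (c : R[i]) (x : A), cnorm (c *: x) = Normc.normc c * cnorm x;
  cnorm_eq0 : forall x : A, cnorm x = 0 -> x = 0;
  cnormM : forall x y : A, cnorm (x * y) <= cnorm x * cnorm y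
}.

#[short(type="normedAlgType")]
HB.structure Definition NormedAlgebra (R : realType) :=
  {A of GRing.Algebra R[i] A & Algebra_isNormed R A}.

(* MathComp-Analysis' normedModType R[i], whose norm takes its values in R[i],
   cannot be joined with algType R[i] by Hierarchy Builder (NumDomain is already
   a join of ring and normed structures). The normed module structure, and with
   it the topology and the uniformity of the norm, is put on an alias instead. *)
Definition normed (R : realType) (A : normedAlgType R) : Type := A.

Section NormedAlias.
Variables (R : realType) (A : normedAlgType R).

HB.instance Definition _ := GRing.Lmodule.copy (normed A) A.

Let norm (x : normed A) : R[i] := (cnorm (x : A))%:C.

Let norm_triangle x y : norm (x + y) <= norm x + norm y.
Proof. by rewrite /norm -rmorphD lecR cnormD. Qed.

Let norm_scale (c : R[i]) x : norm (c *: x) = `|c| * norm x.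
Proof. by rewrite /norm cnormZ rmorphM; case: c. Qed.

Let norm_eq0 x : norm x = 0 -> x = 0.
Proof. by move=> /complexI/cnorm_eq0. Qed.

HB.instance Definition _ := Lmodule_isNormed.Build R[i] (normed A)
  norm_triangle norm_scale norm_eq0.

End NormedAlias.

HB.mixin Record NormedAlgebra_isCStar (R : realType) A
    of NormedAlgebra R A := {
  star : A -> A;
  starK : involutive star;
  starD : forall x y : A, star (x + y) = star x + star y;
  starZ : forall (c : R[i]) (x : A), star (c *: x) = (c^*)%R *: star x;
  starM : forall x y : A, star (x * y) = star y * star x;
  cstar_identity : forall x : A, cnorm (star x * x) = cnorm x ^+ 2;
  norm_complete : forall F : set_system (normed A),
    ProperFilter F -> cauchy F -> cvg F
}.

#[short(type="cstarAlgType")]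
HB.structure Definition CStarAlgebra (R : realType) :=
  {A of NormedAlgebra R A & NormedAlgebra_isCStar R A}.

HB.instance Definition _ (R : realType) (A : cstarAlgType R) :=
  Uniform_isComplete.Build (normed A) (@norm_complete R A).

Section LinearAlgebra.
Variables (K : pzRingType) (V : lmodType K).

Definition linear_span (S : set V) : set V :=
  [set x | exists (n : nat) (c : 'I_n -> K) (v : 'I_n -> V),
    (forall i, S (v i)) /\ x = \sum_(i < n) c i *: v i].

Definition linear_subspace (S : set V) : Prop :=
  S 0 /\ forall (c : K) (x y : V), S x -> S y -> S (c *: x + y).

End LinearAlgebra.

Definition two_sided_ideal (K : pzRingType) (A : lalgType K) (I : set A) : Prop :=
  linear_subspace I /\
  forall a x : A, I x -> I (a * x) /\ I (x * a).

Section CStar.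
Variables (R : realType) (A : cstarAlgType R).

(* A subalgebra is not required to contain the unit of A. *)
Definition star_subalgebra (S : set A) : Prop :=
  [/\ linear_subspace S,
      forall x y : A, S x -> S y -> S (x * y)
    & forall x : A, S x -> S (star x)].

Definition positive_elt : set A := [set a | exists b : A, a = star b * b].

(* A map from the positive cone to [0, +oo] is represented by a function on A
   of which only the values on the positive cone matter. *)
Definition is_weight (tau : A -> \bar R) : Prop :=
  (forall a : A, positive_elt a -> (0 <= tau a)%E) /\
  (forall (l : R) (a b : A), 0 < l -> positive_elt a -> positive_elt b ->
    tau (l%:C *: a + b) = (l%:E * tau a + tau b)%E).

Definition positive_functional (psi : {scalar A}) : Prop :=
  (exists M : R, forall a : A, Normc.normc (psi a) <= M * cnorm a) /\
  (forall a : A, positive_elt a -> 0 <= psi a).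

(* On positive elements psi takes real values, hence the real part. *)
Definition functional_le (psi : {scalar A}) (tau : A -> \bar R) : Prop :=
  forall a : A, positive_elt a -> ((complex.Re (psi a))%:E <= tau a)%E.

Definition regularization (tau0 : A -> \bar R) (a : A) : \bar R :=
  ereal_sup [set (complex.Re (psi a))%:E | psi in
    [set psi : {scalar A} | positive_functional psi /\ functional_le psi tau0]].

Definition delta_unitary (A0 : set A) (delta : R) : set A :=
  [set U | [/\ A0 U, cnorm (star U * U - 1) < delta
             & cnorm (U * star U - 1) < delta]].

Definition eps_invariant (A0 : set A) (tau0 : A -> \bar R) : Prop :=
  forall eps : R, 0 < eps < 1 ->
  exists2 delta : R, 0 < delta &
  forall U a : A, delta_unitary A0 delta U -> positive_elt a ->
    ((1 - eps)%:E * tau0 a <= tau0 (U * a * star U)%R)%E /\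
    (tau0 (U * a * star U)%R <= (1 + eps)%:E * tau0 a)%E.

Definition finite_part (tau : A -> \bar R) : set A :=
  [set a | positive_elt a /\ (tau a < +oo)%E].

Definition finite_span (tau : A -> \bar R) : set A :=
  linear_span (finite_part tau).

(* T is the linear extension of tau to finite_span tau; its values outside
   finite_span tau are irrelevant. *)
Definition linear_extension (tau : A -> \bar R) (T : A -> R[i]) : Prop :=
  (forall (c : R[i]) (x y : A), finite_span tau x -> finite_span tau y ->
    T (c *: x + y) = c * T x + T y) /\
  (forall a : A, finite_part tau a -> T a = (fine (tau a))%:C).

End CStar.

(* Main.v *)
(** The supremum [tau] is additive because the bounded minorants [psi <= tau0] are
directed up to a factor [1 - eta]: given [psi1], [psi2], put
[k = (1 - eta) / eta] and let
  [Q x = inf {k (psi1 + psi2) (y^* y) + tau0 (z^* z) | x = y + z}],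
the quadratic form of the parallel sum of [k (psi1 + psi2)] and [tau0].  It lies
below [tau0] and above [(1 - eta) psi_i], satisfies the parallelogram law and is
invariant under [x |-> U x] for unitary [U]; by the Jordan-von Neumann argument
it is [x |-> psi (x^* x)] for a bounded positive functional [psi].  Thus neither
square roots nor the GNS construction are needed.

By density and continuity of the minorants, [tau (U a U^* ) <= (1 + eps) tau a]
for all [U] in [A] that are nearly unitary.  Taking [U = 1 + t b^*] shows that
[{x | tau (x^* x) < oo}] is stable under right multiplication; by polarization
[J] is spanned by the products [y^* x] of its elements, hence is a two-sided
ideal.  Unitaries leave [tau] invariant; if [b] is skew-adjoint and small and
[c = (1 - b)^-1], then [U = 2 c - 1] is unitary, so
[tau (c z) = tau (z c)] on [J], and [z = (1 - b) w (1 - b)] yields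
[tau (w b) = tau (b w)]. *)

From HB Require Import structures.
Require Import Defs.
From mathcomp Require Import all_boot all_order all_algebra.
From mathcomp Require Import complex.
From mathcomp Require Import all_classical all_reals all_analysis.
From mathcomp Require Import ring lra.
Import Order.TTheory GRing.Theory Num.Theory.
Import numFieldNormedType.Exports.

Local Open Scope classical_set_scope.
Local Open Scope ring_scope.
Local Open Scope complex_scope.

Set Implicit Arguments.
Unset Strict Implicit.
Unset Printing Implicit Defensive.

(** * Complex scalars: modulus and real part *)

Section Scalars.
Variable R : realType.
Implicit Types (t : R) (z w : R[i]).

Lemma normc_real t : Normc.normc t%:C = `|t|.
Proof. by rewrite /= expr0n addr0 sqrtr_sqr. Qed.

Lemma normrE_complex z : `|z| = (Normc.normc z)%:C.
Proof. by case: z. Qed.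

Lemma ReD z w : complex.Re (z + w) = complex.Re z + complex.Re w.
Proof. by case: z; case: w. Qed.

Lemma ReN z : complex.Re (- z) = - complex.Re z.
Proof. by case: z. Qed.

Lemma ReZ t z : complex.Re (t%:C * z) = t * complex.Re z.
Proof. by case: z => a b /=; rewrite mul0r subr0. Qed.

Lemma le_Re_normc z : complex.Re z <= Normc.normc z.
Proof.
have := normc_ge_Re z; rewrite normrE_complex lecR; apply: le_trans; exact: ler_norm.
Qed.

Lemma ge0_complexE z : 0 <= z -> z = (complex.Re z)%:C.
Proof. by case: z => a b; rewrite lecE /= => /andP[/eqP-> _]. Qed.

End Scalars.

(** * Norm, involution, positive elements and the Neumann series *)

Section Basics.
Variables (R : realType) (A : cstarAlgType R).
Implicit Types (x y z a b : A) (t : R).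

Lemma cnorm0 : cnorm (0 : A) = 0 :> R.
Proof. by rewrite -(scale0r (0 : A)) cnormZ Normc.normc0 mul0r. Qed.

Lemma cnormN x : cnorm (- x) = cnorm x.
Proof.
rewrite -scaleN1r cnormZ.
have -> : (-1 : R[i]) = (-1)%:C by rewrite rmorphN1.
by rewrite normc_real normrN1 mul1r.
Qed.

Lemma cnormZr t x : cnorm (t%:C *: x) = `|t| * cnorm x.
Proof. by rewrite cnormZ normc_real. Qed.

Lemma cnorm_ge0 x : 0 <= cnorm x.
Proof.
by have := cnormD x (- x); rewrite subrr cnorm0 cnormN; lra.
Qed.

Lemma cnormB x y : cnorm (x - y) <= cnorm x + cnorm y.
Proof. by rewrite -(cnormN y); exact: cnormD. Qed.

Lemma cnormC x y : cnorm (x - y) = cnorm (y - x).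
Proof. by rewrite -cnormN opprB. Qed.

Lemma star0 : star (0 : A) = 0.
Proof. by rewrite -(scale0r (0 : A)) starZ rmorph0 !scale0r. Qed.

Lemma starN x : star (- x) = - star x.
Proof. by apply/eqP; rewrite -subr_eq0 opprK -starD addNr star0. Qed.

Lemma starB x y : star (x - y) = star x - star y.
Proof. by rewrite starD starN. Qed.

Lemma star1 : star (1 : A) = 1.
Proof.
by have := starM (1 : A) (star 1); rewrite starK mul1r starK.
Qed.

Lemma starZr t x : star (t%:C *: x) = t%:C *: star x.
Proof. by rewrite starZ; congr (_ *: _); exact: conjc_real. Qed.

Lemma starZi x : star ('i *: x) = - ('i *: star x).
Proof.
rewrite starZ -scaleNr; congr (_ *: _).
by apply/eqP; rewrite eq_complex /= oppr0 !eqxx.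
Qed.

(** The C*-identity gives [cnorm y ^+ 2 <= cnorm (star y) * cnorm y]; cancel [cnorm y] and use this
    for both [x] and [star x]. *)
Lemma cnorm_star x : cnorm (star x) = cnorm x.
Proof.
suff le y : cnorm y <= cnorm (star y).
  by apply/eqP; rewrite eq_le le -{2}(starK x) le.
have := cnormM (star y) y; rewrite cstar_identity expr2.
have [->|y0] := eqVneq (cnorm y) 0; first by rewrite cnorm_ge0.
by rewrite ler_pM2r // lt_neqAle eq_sym y0 cnorm_ge0.
Qed.

Lemma scaleiK x : 'i *: ('i *: x) = - x.
Proof. by rewrite scalerA -expr2 sqr_i scaleN1r. Qed.

Lemma cnorm_scalei x : cnorm ('i *: x) = cnorm x.
Proof.
rewrite cnormZ (_ : Normc.normc _ = 1) ?mul1r //.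
by rewrite /= expr0n expr1n add0r sqrtr1.
Qed.

Lemma complex_scaleE (c : R[i]) x :
  c *: x = (complex.Re c)%:C *: x + (complex.Im c)%:C *: ('i *: x).
Proof. by rewrite scalerA -scalerDl [_ * 'i]mulrC -complexE. Qed.

Lemma positive_sq x : positive_elt (star x * x).
Proof. by exists x. Qed.

Lemma positive0 : positive_elt (0 : A).
Proof. by exists 0; rewrite mulr0. Qed.

Lemma positiveZ t a : 0 <= t -> positive_elt a -> positive_elt (t%:C *: a).
Proof.
move=> t0 [x ->]; exists ((Num.sqrt t)%:C *: x).
by rewrite starZr -scalerAl -scalerAr scalerA -rmorphM -expr2 sqr_sqrtr.
Qed.

Lemma positive_conj a b : positive_elt a -> positive_elt (b * a * star b).
Proof. by move=> [x ->]; exists (x * star b); rewrite starM starK !mulrA. Qed.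

(** Brings completeness, stated for filters on [normed A], to sequences with real errors measured by
    [cnorm]. *)
Lemma cauchy_seq_lim (u : nat -> A) :
    (forall e : R, 0 < e -> exists N, forall n, (N <= n)%N ->
      cnorm (u N - u n) < e) ->
  exists l : A, forall e : R, 0 < e -> exists N, forall n, (N <= n)%N ->
    cnorm (l - u n) < e.
Proof.
move=> cu.
pose v : nat -> normed A := u.
have cv : cauchy (v @ \oo).
  apply: cauchy_exP => e e0.
  have eE := ge0_complexE (ltW e0).
  have r0 : 0 < complex.Re e by rewrite eE ltcR in e0.
  have [N uN] := cu _ r0; exists (v N).
  exists N => // n /= Nn.
  rewrite -ball_normE /ball_ /=.
  rewrite /Num.norm /= eE ltcR; exact: uN.
have cvv : cvg (v @ \oo) := norm_complete _ (fmap_proper_filter _ _) cv.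
have vl := cvv; set l := lim _ in vl; exists l.
move=> e e0.
have : nbhs (v @ \oo) (ball l e%:C).
  apply: vl; apply: nbhsx_ballx; by rewrite ltcR.
move=> [N _ vN]; exists N => n Nn.
have := vN n Nn; rewrite -ball_normE /ball_ /=.
by rewrite {1}/Num.norm /= ltcR.
Qed.

Lemma dense_approx (S : set A) : dense (S : set (normed A)) ->
  forall x (e : R), 0 < e -> exists2 y, S y & cnorm (x - y) < e.
Proof.
move=> dS x e e0.
have e0' : 0 < e%:C :> R[i] by rewrite ltcR.
have [y [xy Sy]] :=
  dS (ball (x : normed A) e%:C) (ex_intro _ _ (ballxx _ e0')) (ball_open _ _).
exists y => //; move: xy; rewrite -ball_normE /ball_ /=.
by rewrite {1}/Num.norm /= ltcR.
Qed.

(** Geometric series: the partial sums satisfy [u n * (1 - b) = 1 - b ^+ n], and the powers of [b]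
    decay like those of [2^-1]. *)
Lemma neumann b : cnorm b <= 2^-1 ->
  exists c : A, c * (1 - b) = 1 /\ (1 - b) * c = 1.
Proof.
move=> b2.
pose u n : A := \sum_(k < n) b ^+ k.
have uS n : u n.+1 = u n + b ^+ n by rewrite /u big_ord_recr.
(* The bound starts at the first power, so that [cnorm 1] does not enter. *)
have bn n : cnorm (b ^+ n.+1) <= 2^-1 ^+ n.+1.
  elim: n => [//|n IHn]; rewrite exprS [leRHS]exprS.
  apply: le_trans (cnormM _ _) _; apply: ler_pM => //; exact: cnorm_ge0.
(* The right-hand side is the sum of [2^-1 ^+ j] over [k < j <= k + n]. *)
have un k n : cnorm (u k.+1 - u (k.+1 + n)%N) <= 2^-1 ^+ k - 2^-1 ^+ (k + n)%N.
  elim: n => [|n IHn]; first by rewrite !addn0 !subrr cnorm0.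
  rewrite addnS [u (_ + _)%N.+1]uS opprD addrA; apply: le_trans (cnormB _ _) _.
  have := bn (k + n)%N; rewrite -addSn => /(lerD IHn)/le_trans; apply.
  rewrite addSn addnS !exprS; lra.
have ge0 n : 0 <= 2^-1 ^+ n :> R by rewrite exprn_ge0 // invr_ge0.
have small (e : R) : 0 < e -> exists n, 2^-1 ^+ n < e.
  move=> e0; have : geometric 1 (2^-1 : R) n @[n --> \oo] --> (0 : R).
    by apply: cvg_geometric; rewrite ger0_norm; lra.
  move=> /cvgrPdist_lt/(_ e e0)[n _ /(_ n (leqnn n))] /=.
  by rewrite mul1r sub0r normrN ger0_norm //; exists n.
have [e e0|c uc] := @cauchy_seq_lim u.
  have [k ke] := small e e0; exists k.+1 => n kn.
  rewrite -(subnKC kn); apply: le_lt_trans (un _ _) _.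
  have := ge0 (k + (n - k.+1))%N; lra.
have uE n : (u n * (1 - b) = 1 - b ^+ n) /\ ((1 - b) * u n = 1 - b ^+ n).
  elim: n => [|n [IH1 IH2]]; first by rewrite /u big_ord0 mul0r mulr0 subrr.
  rewrite uS mulrDl [_ * (u n + _)]mulrDr IH1 IH2 mulrBr mulrBl mulr1 mul1r.
  by rewrite -exprS -exprSr addrA subrK.
have eq0 z : (forall e : R, 0 < e -> cnorm z <= e) -> z = 0.
  move=> ze; apply: cnorm_eq0; apply/eqP; rewrite eq_le cnorm_ge0 andbT.
  by apply/ler_addgt0Pr => e e0; rewrite add0r ze.
have M0 : 0 < cnorm (1 - b) + 1 by have := cnorm_ge0 (1 - b); lra.
have lim e : 0 < e -> exists n,
    cnorm (c - u n) * (cnorm (1 - b) + 1) <= e / 2 /\ cnorm (b ^+ n) <= e / 2.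
  move=> e0; have [|N cN] := uc (e / 2 / (cnorm (1 - b) + 1)).
    by rewrite !divr_gt0.
  have [|n ne] := small (e / 2); first by lra.
  exists (maxn N n).+1; split.
    rewrite -ler_pdivlMr //; exact/ltW/cN/(leq_trans (leq_maxl _ _) (leqnSn _)).
  apply: le_trans (bn _) _.
  apply: le_trans (ltW ne).
  apply: ler_wiXn2l; last exact: leq_trans (leq_maxr _ _) (leqnSn _).
    by rewrite invr_ge0.
  by rewrite invf_le1 // ler1n.
exists c; split; apply/eqP; rewrite -subr_eq0; apply/eqP/eq0 => e /lim[n [cn bne]];
  have [E1 E2] := uE n.
- have -> : c * (1 - b) - 1 = (c - u n) * (1 - b) - b ^+ n.
    by rewrite mulrBl E1 opprB [b ^+ n - 1]addrC addrA addrK.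
  have := cnormB ((c - u n) * (1 - b)) (b ^+ n).
  have := cnormM (c - u n) (1 - b); have := cnorm_ge0 (c - u n); nra.
- have -> : (1 - b) * c - 1 = (1 - b) * (c - u n) - b ^+ n.
    by rewrite mulrBr E2 opprB [b ^+ n - 1]addrC addrA addrK.
  have := cnormB ((1 - b) * (c - u n)) (b ^+ n).
  have := cnormM (1 - b) (c - u n); have := cnorm_ge0 (c - u n); nra.
Qed.

End Basics.

(** * Linear functionals, skew-adjoint parts and the Cayley transform *)

Section Functionals.
Variables (R : realType) (A : cstarAlgType R).
Implicit Types (x y z a b c : A) (t s : R) (psi : {scalar A}).

Lemma scalar_of (f : A -> R[i]) :
    (forall (k : R[i]) x y, f (k *: x + y) = k * f x + f y) ->
  exists g : {scalar A}, g =1 f.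
Proof.
move=> lf; pose L := GRing.isLinear.Build R[i] A R[i] *%R f lf.
by exists (HB.pack_for {scalar A} f L).
Qed.

Lemma Re_scalarD psi x y :
  complex.Re (psi (x + y)) = complex.Re (psi x) + complex.Re (psi y).
Proof. by rewrite linearD ReD. Qed.

Lemma Re_scalarN psi x : complex.Re (psi (- x)) = - complex.Re (psi x).
Proof. by rewrite linearN ReN. Qed.

Lemma Re_scalarB psi x y :
  complex.Re (psi (x - y)) = complex.Re (psi x) - complex.Re (psi y).
Proof. by rewrite linearB ReD ReN. Qed.

Lemma Re_scalarZ psi t x :
  complex.Re (psi (t%:C *: x)) = t * complex.Re (psi x).
Proof. by rewrite linearZ ReZ. Qed.

Lemma positive_functional_ge0 psi a : positive_functional psi ->
  positive_elt a -> 0 <= complex.Re (psi a).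
Proof.
by move=> [_ p0] /p0; rewrite lecE => /andP[].
Qed.

Lemma positive_functional_bounded psi : positive_functional psi ->
  exists2 M, 0 <= M & forall a, Normc.normc (psi a) <= M * cnorm a.
Proof.
move=> [[M pM] _]; exists `|M| => // a; apply: le_trans (pM a) _.
by apply: ler_wpM2r; [exact: cnorm_ge0|exact: ler_norm].
Qed.

Lemma archimedean_le0 t s : (forall n : nat, n%:R * t <= s) -> t <= 0.
Proof.
move=> ts; rewrite leNgt; apply/negP => t0.
have s0 : 0 <= s by have := ts 0%N; rewrite mul0r.
have := archi_boundP (divr_ge0 s0 (ltW t0)).
by rewrite ltr_pdivrMr // ltNge ts.
Qed.

(** The terms are [(b - star b) / 2] and [- 'i (b + star b) / 2], divided by [t = 2 |b| + 1] to
    bring their norms under the bound [2^-1] of the Neumann series. *)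
Lemma skew_decomposition b : exists (t : R) (k1 k2 : A),
  [/\ star k1 = - k1, star k2 = - k2, cnorm k1 <= 2^-1, cnorm k2 <= 2^-1 &
      b = t%:C *: (k1 + 'i *: k2)].
Proof.
pose t := cnorm b *+ 2 + 1.
have t0 : 0 < t by rewrite /t mulr2n; have := cnorm_ge0 b; lra.
pose u := (t^-1 / 2)%:C : R[i].
have u0 : `|t^-1 / 2| = t^-1 / 2 by rewrite ger0_norm // ?divr_ge0 // invr_ge0 ltW.
have bound : t^-1 / 2 * (cnorm b + cnorm b) <= 2^-1.
  rewrite -mulr2n -mulrA mulrC ler_pdivrMr //.
  rewrite /t mulr2n; have := cnorm_ge0 b; lra.
exists t, (u *: (b - star b)), (- ('i *: (u *: (b + star b)))); split.
- by rewrite /u starZr starB starK -scalerN opprB.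
- by rewrite starN starZi /u starZr starD starK [star b + b]addrC.
- rewrite cnormZr u0; apply: le_trans bound; apply: ler_wpM2l.
    by rewrite divr_ge0 // invr_ge0 ltW.
  by apply: le_trans (cnormB _ _) _; rewrite cnorm_star.
- rewrite cnormN cnorm_scalei cnormZr u0; apply: le_trans bound; apply: ler_wpM2l.
    by rewrite divr_ge0 // invr_ge0 ltW.
  by apply: le_trans (cnormD _ _) _; rewrite cnorm_star.
rewrite scalerN scaleiK opprK -scalerDr addrACA addNr addr0 scalerA scalerDr.
rewrite -scalerDl -rmorphM -rmorphD (_ : _ + _ = 1) ?scale1r //.
by field; rewrite gt_eqF.
Qed.

(** Here [2 c - 1] is the Cayley transform [(1 + b) (1 - b)^-1]. As [star c] inverts [1 + b],
    inserting [(1 + b) + (1 - b) = 2] between [c] and [star c], in either order, gives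
    [c + star c = 2 c (star c) = 2 (star c) c], which amounts to unitarity. *)
Lemma cayley_unitary b : star b = - b -> cnorm b <= 2^-1 -> exists c,
  [/\ c * (1 - b) = 1, (1 - b) * c = 1, star (c *+ 2 - 1) * (c *+ 2 - 1) = 1 &
      (c *+ 2 - 1) * star (c *+ 2 - 1) = 1].
Proof.
move=> sb b2; have [c [c1 c2]] := neumann b2.
have sc1 : star c * (1 + b) = 1.
  by have := congr1 star c2; rewrite starM starB star1 sb opprK.
have sc2 : (1 + b) * star c = 1.
  by have := congr1 star c1; rewrite starM starB star1 sb opprK.
have E1 : c + star c = (c * star c) *+ 2.
  rewrite [LHS](_ : _ = c * (1 + b) * star c + c * (1 - b) * star c).
    by rewrite -mulrDl -mulrDr addrACA subrr addr0 mulrDr mulr1 mulrDl mulr2n.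
  by rewrite c1 mul1r -mulrA sc2 mulr1.
have E2 : star c + c = (star c * c) *+ 2.
  rewrite [LHS](_ : _ = star c * (1 - b) * c + star c * (1 + b) * c).
    by rewrite -mulrDl -mulrDr addrACA addNr addr0 mulrDr mulr1 mulrDl mulr2n.
  by rewrite sc1 mul1r -mulrA c2 mulr1.
have cay x y : x + y = (x * y) *+ 2 -> (x *+ 2 - 1) * (y *+ 2 - 1) = 1.
  move=> xy; rewrite mulrBl mul1r mulrBr mulr1 mulrnAl mulrnAr -xy mulrnDl.
  by rewrite [x *+ 2 + _]addrC addrK opprB addrC subrK.
exists c; split => //; rewrite starB star1 mulr2n starD -mulr2n; exact: cay.
Qed.

End Functionals.

(** * Additive real functions with a local bound *)

Section AdditiveFunctions.
Variable R : realType.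

(** Removing the integer part of [t] bounds the error [g t - t * g 1] for all [t >= 0]. The error is
    additive, so its natural multiples obey the same bound and it vanishes. *)
Lemma additive_homogeneous (g : R -> R) (C : R) :
    (forall s t, g (s + t) = g s + g t) ->
    (forall t, 0 <= t <= 1 -> `|g t| <= C) ->
  forall t, g t = t * g 1.
Proof.
move=> gD gC.
have g0 : g 0 = 0 by have := gD 0 0; rewrite addr0; lra.
have gN t : g (- t) = - g t by have := gD t (- t); rewrite subrr g0; lra.
have gn n t : g (n%:R * t) = n%:R * g t.
  elim: n => [|n IHn]; first by rewrite !mul0r.
  by rewrite -natr1 !mulrDl !mul1r gD IHn.
have bound t : 0 <= t -> `|g t - t * g 1| <= C + `|g 1|.
  move=> t0; have /andP[mt tm] := truncn_itv t0.
  set m := Num.truncn t in mt tm.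
  have -> : g t = m%:R * g 1 + g (t - m%:R).
    by rewrite gD gN -(gn m 1) mulr1; lra.
  have f01 : 0 <= t - m%:R <= 1 by move: tm; rewrite -natr1 => tm; lra.
  have -> : m%:R * g 1 + g (t - m%:R) - t * g 1 =
    g (t - m%:R) - (t - m%:R) * g 1 by ring.
  apply: le_trans (ler_normB _ _) _; apply: lerD; first exact: gC.
  rewrite normrM; apply: ler_piMl => //.
  by rewrite ger0_norm; move: f01 => /andP[].
have pos t : 0 <= t -> g t = t * g 1.
  move=> t0.
  have nb n : `|n%:R * (g t - t * g 1)| <= C + `|g 1|.
    rewrite mulrBr mulrA -gn; apply: bound; exact: mulr_ge0.
  have le0 : g t - t * g 1 <= 0.
    apply: (@archimedean_le0 _ _ (C + `|g 1|)) => n.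
    exact: le_trans (ler_norm _) (nb n).
  have ge0 : - (g t - t * g 1) <= 0.
    apply: (@archimedean_le0 _ _ (C + `|g 1|)) => n.
    by rewrite mulrN; apply: le_trans (ler_norm _) _; rewrite normrN.
  lra.
move=> t; have [/pos//|/ltW t0] := leP 0 t.
have := pos (- t); rewrite gN oppr_ge0 => /(_ t0); lra.
Qed.

End AdditiveFunctions.

(** * From invariant quadratic forms to positive functionals *)

Section QuadraticForms.
Variables (R : realType) (A : cstarAlgType R) (Q : A -> R) (K : R).
Implicit Types (x y z a b c : A) (t s : R).
Hypothesis Q_parallelogram :
  forall x y, Q (x + y) + Q (x - y) = 2 * Q x + 2 * Q y.
Hypothesis Qi : forall x, Q ('i *: x) = Q x.
Hypothesis Q_unitary : forall U x, star U * U = 1 -> U * star U = 1 ->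
  Q (U * x) = Q x.
Hypothesis K_ge0 : 0 <= K.
Hypothesis Q_bounded : forall x, 0 <= Q x <= K * cnorm x ^+ 2.

(** The real part of the sesquilinear form polarizing [Q]; the imaginary part is [f x ('i *: y)]. *)
Let f x y := (Q (x + y) - Q (x - y)) / 4.

Let Q0 : Q 0 = 0.
Proof. by have := Q_parallelogram 0 0; rewrite subr0 addr0; lra. Qed.

Let QN x : Q (- x) = Q x.
Proof. by have := Q_parallelogram 0 x; rewrite add0r sub0r Q0; lra. Qed.

Let fC x y : f x y = f y x.
Proof. by rewrite /f [x + y]addrC -(opprB y x) QN. Qed.

Let f0 y : f 0 y = 0.
Proof. by rewrite /f add0r sub0r QN subrr mul0r. Qed.

Let fxx x : f x x = Q x.
Proof. by rewrite /f subrr Q0; have := Q_parallelogram x x; rewrite subrr Q0; lra. Qed.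

(** The parallelogram laws for [x + y], [x' + y] and for [x - y], [x' - y] share the term
    [Q (x - x')], which cancels in their difference. *)
Let fD_half x x' y : f x y + f x' y = f (x + x') (y + y) / 2.
Proof.
have := Q_parallelogram (x + y) (x' + y); have := Q_parallelogram (x - y) (x' - y).
rewrite /f addrACA (addrACA x y x' y) -!opprD.
rewrite (_ : x - y - (x' - y) = x - x'); last by rewrite opprB addrA subrK.
rewrite (_ : x + y - (x' + y) = x - x'); last by rewrite opprD addrACA subrr addr0.
lra.
Qed.

Let fDl x x' y : f (x + x') y = f x y + f x' y.
Proof. by have := fD_half (x + x') 0 y; rewrite f0 !addr0 fD_half. Qed.

Let fNl x y : f (- x) y = - f x y.
Proof. by have := fDl x (- x) y; rewrite subrr f0; lra. Qed.

Let fDr x y y' : f x (y + y') = f x y + f x y'.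
Proof. by rewrite fC fDl !(fC x). Qed.

Let fNr x y : f x (- y) = - f x y.
Proof. by rewrite fC fNl fC. Qed.

Let f_bounded x y : `|f x y| <= K * (cnorm x + cnorm y) ^+ 2.
Proof.
have bnd z : cnorm z <= cnorm x + cnorm y ->
    0 <= Q z <= K * (cnorm x + cnorm y) ^+ 2.
  move=> zb; have /andP[-> Qz] := Q_bounded z; apply: le_trans Qz _.
  apply: ler_wpM2l => //; apply: lerXn2r => //; rewrite nnegrE ?cnorm_ge0 //.
  by rewrite addr_ge0 // cnorm_ge0.
have /andP[p1 p2] := bnd _ (cnormD x y); have /andP[m1 m2] := bnd _ (cnormB x y).
by rewrite /f ler_norml; apply/andP; split; lra.
Qed.

(** [f_bounded] is uniform for [t] in [[0, 1]], the local bound required of an additive function of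
    [t]. *)
Let fZl t x y : f (t%:C *: x) y = t * f x y.
Proof.
pose g s := f (s%:C *: x) y.
have <- : g 1 = f x y by rewrite /g scale1r.
rewrite -[LHS]/(g t).
apply: (additive_homogeneous (C := K * (cnorm x + cnorm y) ^+ 2)) =>
  [s s'|s /andP[s0 s1]].
  by rewrite /g rmorphD scalerDl fDl.
apply: le_trans (f_bounded _ _) _; apply: ler_wpM2l => //.
apply: lerXn2r; rewrite ?nnegrE ?addr_ge0 ?cnorm_ge0 //.
apply: lerD => //; rewrite cnormZr ger0_norm //.
by apply: ler_piMl => //; exact: cnorm_ge0.
Qed.

Let fZr t x y : f x (t%:C *: y) = t * f x y.
Proof. by rewrite fC fZl fC. Qed.

Let fii x y : f ('i *: x) ('i *: y) = f x y.
Proof. by rewrite /f -scalerDr -scalerBr !Qi. Qed.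

Let fil x y : f ('i *: x) y = - f x ('i *: y).
Proof. by rewrite -fii scaleiK fNl. Qed.

Let f_unitary U x y : star U * U = 1 -> U * star U = 1 ->
  f (U * x) y = f x (star U * y).
Proof.
move=> U1 U2; rewrite -{1}(mul1r y) -U2 -mulrA /f -mulrDr -mulrBr.
by rewrite !Q_unitary.
Qed.

(* Unitary invariance under [2 c - 1], [c = (1 - b)^-1], gives the adjoint
   relation for [c], and hence for its inverse [1 - b]. *)
Let f_skew b x y : star b = - b -> cnorm b <= 2^-1 -> f (b * x) y = f x (star b * y).
Proof.
move=> sb b2; have [c [c1 c2 U1 U2]] := cayley_unitary sb b2.
have fc x' y' : f (c * x') y' = f x' (star c * y').
  have := f_unitary x' y' U1 U2.
  rewrite starB star1 mulr2n starD !mulrBl !mulrDl !mul1r.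
  rewrite !fDl !fDr fNl fNr; lra.
have := fc ((1 - b) * x) (star (1 - b) * y).
rewrite !mulrA c1 -starM c2 star1 !mul1r starB star1 !mulrBl !mul1r.
rewrite !fDl !fDr !fNl !fNr; lra.
Qed.

(** Both sides are real linear in [b], and [fil] moves ['i] across, so small skew-adjoint elements
    suffice. *)
Let f_adjoint b x y : f (b * x) y = f x (star b * y).
Proof.
have [t [k1 [k2 [s1 s2 n1 n2 ->]]]] := skew_decomposition b.
rewrite starZr starD starZi -!scalerAl !mulrDl mulNr fZl fZr fDl fDr f_skew //.
by rewrite -!scalerAl fil f_skew // fNr -scalerAr.
Qed.

(** The functional is [a |-> <a, 1>] for the form with real part [f]; the adjoint relation turns
    [<star x * x, 1>] into [<x, x>]. *)
Lemma quadratic_form_functional : exists2 psi : {scalar A},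
  positive_functional psi & forall x, complex.Re (psi (star x * x)) = Q x.
Proof.
pose F a : R[i] := (f a 1) +i* (f a ('i *: 1)).
have [k x y|psi psiE] := @scalar_of _ A F.
  rewrite /F (complex_scaleE k x) !fDl !fZl !fil scaleiK fNr.
  by case: k => p q; apply/eqP; rewrite eq_complex /=; apply/andP; split; apply/eqP; lra.
have sqE x : psi (star x * x) = (Q x)%:C.
  rewrite psiE /F !f_adjoint starK mulr1 fxx -scalerAr mulr1.
  (* Symmetry and [fil] make [f x ('i *: x)] its own opposite, so the imaginary part vanishes. *)
  by have := fil x x; rewrite fC => E; congr (_ +i* _); lra.
exists psi; last by move=> x; rewrite sqE.
split; last first.
  by move=> _ [x ->]; rewrite sqE lecR; have /andP[] := Q_bounded x.
(* Normalizing [a] to norm one turns the quadratic bound [f_bounded] into a linear one. *)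
have fbnd a y : `|f a y| <= K * (1 + cnorm y) ^+ 2 * cnorm a.
  have [a0|a0] := eqVneq (cnorm a) 0.
    by rewrite (cnorm_eq0 _ a0) f0 normr0 cnorm0 mulr0.
  have {}a0 : 0 < cnorm a by rewrite lt_neqAle eq_sym a0 cnorm_ge0.
  rewrite [in f a y](_ : a = (cnorm a)%:C *: ((cnorm a)^-1%:C *: a)); last first.
    by rewrite scalerA -rmorphM divff ?gt_eqF // scale1r.
  rewrite fZl normrM (ger0_norm (ltW a0)) mulrC.
  set a' := _ *: a; have na' : cnorm a' = 1.
    by rewrite cnormZr ger0_norm ?invr_ge0 ?ltW // mulVf // gt_eqF.
  rewrite ler_pM2r //; apply: le_trans (f_bounded _ _) _.
  by rewrite na'.
exists (K * (1 + cnorm (1 : A)) ^+ 2 * 2) => a.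
have normc_le (p q : R) : Normc.normc (p +i* q) <= `|p| + `|q|.
  rewrite -(ger0_norm (addr_ge0 (normr_ge0 p) (normr_ge0 q))) -sqrtr_sqr /=.
  apply: ler_wsqrtr; rewrite sqrrD !real_normK ?num_real //.
  by rewrite addrAC lerDl mulrn_wge0 // mulr_ge0.
rewrite psiE; apply: le_trans (normc_le _ _) _.
have := fbnd a 1; have := fbnd a ('i *: 1); rewrite cnorm_scalei; lra.
Qed.

End QuadraticForms.

(** * Identities for the squares [star x * x] *)

Section Squares.
Variables (R : realType) (A : cstarAlgType R).
Implicit Types (x y z a b c : A) (t s : R) (psi : {scalar A}).

Lemma sqZ t x : star (t%:C *: x) * (t%:C *: x) = (t ^+ 2)%:C *: (star x * x).
Proof. by rewrite starZr -scalerAl -scalerAr scalerA -rmorphM. Qed.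

Lemma sqi x : star ('i *: x) * ('i *: x) = star x * x.
Proof. by rewrite starZi mulNr -scalerAl -scalerAr scaleiK opprK. Qed.

Lemma sq_unitary U x : star U * U = 1 -> star (U * x) * (U * x) = star x * x.
Proof. by move=> U1; rewrite starM -!mulrA (mulrA _ U) U1 mul1r. Qed.

Lemma sqD x y :
  star (x + y) * (x + y) = star x * x + star y * y + (star x * y + star y * x).
Proof. by rewrite starD mulrDl !mulrDr [star y * x + _]addrC addrACA. Qed.

Lemma sqB x y :
  star (x - y) * (x - y) = star x * x + star y * y - (star x * y + star y * x).
Proof. by rewrite sqD starN !mulrN !mulNr opprK -opprD. Qed.

Lemma sq_parallelogram x y :
  star (x + y) * (x + y) + star (x - y) * (x - y) =
  2%:C *: (star x * x) + 2%:C *: (star y * y).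
Proof.
by rewrite sqB sqD addrACA subrr addr0 -scalerDr rmorphD rmorph1 scalerDl scale1r.
Qed.

(** Each difference isolates the two cross terms; multiplication by ['i] makes the [star x * y]
    terms cancel. *)
Lemma sq_polarization x y :
  4%:C *: (star y * x) =
  (star (x + y) * (x + y) - star (x - y) * (x - y)) +
  'i *: (star (x + 'i *: y) * (x + 'i *: y) - star (x - 'i *: y) * (x - 'i *: y)).
Proof.
have E (u v : A) : star (u + v) * (u + v) - star (u - v) * (u - v) =
    2%:C *: (star u * v + star v * u).
  rewrite sqB sqD opprB addrC addrA subrK.
  by rewrite rmorphD rmorph1 scalerDl scale1r.
rewrite !E starZi mulNr -scalerAl -scalerAr -scalerBr.
rewrite (scalerA 'i 2%:C) [_ * 2%:C]mulrC -(scalerA 2%:C) scaleiK -scalerDr opprB.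
rewrite [_ + (_ - _)]addrC addrA subrK scalerDr -scalerDl -rmorphD.
by congr (_%:C *: _); ring.
Qed.

End Squares.

(** * Elementary properties of weights *)

Section Weights.
Variables (R : realType) (A : cstarAlgType R) (tau : A -> \bar R).
Implicit Types (x y z a b c : A) (t s : R) (psi : {scalar A}).
Hypothesis htau : is_weight tau.

Lemma weight_ge0 a : positive_elt a -> (0 <= tau a)%E.
Proof. by case: htau => + _; apply. Qed.

Lemma weightD a b : positive_elt a -> positive_elt b ->
  tau (a + b) = (tau a + tau b)%E.
Proof.
move=> pa pb; have := htau.2 1 a b ltr01 pa pb.
by rewrite scale1r mul1e.
Qed.

(** Scaling is assumed for [l > 0] only, so [tau 0 = tau 0 + tau 0] leaves [0] and [+oo]; the latter
    spreads to every [a = a + 0]. *)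
Lemma weight0 : tau 0 = 0%E \/ forall a, positive_elt a -> tau a = +oo%E.
Proof.
have := weight_ge0 (positive0 A); have := weightD (positive0 A) (positive0 A).
rewrite addr0; case E : (tau 0) => [r| |] //.
  by move=> [rr] _; left; congr (_ %:E); lra.
move=> _ _; right => a pa; rewrite -[a]addr0 weightD //; last exact: positive0.
by rewrite E addey //; apply: contraTneq (weight_ge0 pa) => ->.
Qed.

Lemma weightZ t a : tau 0 = 0%E -> 0 < t -> positive_elt a ->
  tau (t%:C *: a) = (t%:E * tau a)%E.
Proof.
move=> t0 tp pa; have := htau.2 t a 0 tp pa (positive0 A).
by rewrite addr0 t0 adde0.
Qed.

End Weights.

(** * Minorants of a weight and their parallel sum *)

Section Minorants.
Variables (R : realType) (A : cstarAlgType R) (tau0 : A -> \bar R).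
Implicit Types (x y z a b c : A) (t s : R) (psi : {scalar A}).

Definition minorant psi : Prop := positive_functional psi /\ functional_le psi tau0.

Section ParallelSum.
Variables (psi1 psi2 : {scalar A}) (eta : R).
Hypotheses (htau : is_weight tau0) (tau00 : tau0 0 = 0%E).
Hypotheses (min1 : minorant psi1) (min2 : minorant psi2) (eta01 : 0 < eta < 1).

(** The parallel sum of [k q] and [q] is [k / (k + 1) q], that is [(1 - eta) q] for this [k]. *)
Let k : R := (1 - eta) / eta.

Let k_ge0 : 0 <= k.
Proof. by case/andP: eta01 => e0 e1; rewrite divr_ge0 //; lra. Qed.

Let p x := k * (complex.Re (psi1 (star x * x)) + complex.Re (psi2 (star x * x))).

(** Only decompositions with real [tau0 (star z * z)] enter, so the infimum is taken in [R]; [z = 0]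
    is always among them as [tau0 0 = 0]. *)
Let S x : set R := [set r | exists y z s,
  [/\ x = y + z, tau0 (star z * z) = s%:E & r = p y + s]].

(* The quadratic form of the parallel sum of [k (psi1 + psi2)] and [tau0]. *)
Let Q x := inf (S x).

Let p_ge0 x : 0 <= p x.
Proof.
apply: mulr_ge0 => //; apply: addr_ge0.
  exact: positive_functional_ge0 min1.1 (positive_sq x).
exact: positive_functional_ge0 min2.1 (positive_sq x).
Qed.

Let pZ t x : p (t%:C *: x) = t ^+ 2 * p x.
Proof. by rewrite /p sqZ !Re_scalarZ; ring. Qed.

Let p_parallelogram x y : p (x + y) + p (x - y) = 2 * p x + 2 * p y.
Proof.
rewrite /p -mulrDr addrACA -!Re_scalarD sq_parallelogram !Re_scalarD !Re_scalarZ.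
ring.
Qed.

Let S_self x : S x (p x).
Proof. by exists x, 0, 0; split; rewrite ?addr0 // mulr0. Qed.

Let S_ge0 x r : S x r -> 0 <= r.
Proof.
move=> [y [z [s [_ zs ->]]]]; apply: addr_ge0 => //.
by rewrite -lee_fin -zs; apply: weight_ge0 htau _ (positive_sq z).
Qed.

Let Q_le x r : S x r -> Q x <= r.
Proof. by move=> Sr; apply: ge_inf Sr; exists 0 => u; exact: S_ge0. Qed.

Let le_Q x r : (forall u, S x u -> r <= u) -> r <= Q x.
Proof. by move=> ru; apply: lb_le_inf => //; exists (p x). Qed.

(** Sums and differences of decompositions of [x] and [x'] decompose [x + x'] and [x - x'], and both
    terms of the cost obey the parallelogram law. *)
Let S_parallelogram x x' r r' : S x r -> S x' r' ->
  exists u v, [/\ S (x + x') u, S (x - x') v & u + v = 2 * r + 2 * r'].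
Proof.
move=> [y [z [s [xyz zs rE]]]] [y' [z' [s' [xyz' zs' rE']]]].
have : (tau0 (star (z + z') * (z + z'))%R + tau0 (star (z - z') * (z - z'))%R =
    (2 * s + 2 * s')%:E)%E.
  rewrite -weightD //; try exact: positive_sq.
  rewrite sq_parallelogram weightD //; try exact/positiveZ/positive_sq.
  by rewrite !weightZ // ?zs ?zs'; try exact: positive_sq.
(* A real sum leaves only the case of two real values. *)
case E1 : (tau0 _) => [u| |]; case E2 : (tau0 _) => [v| |] //= [uv].
exists (p (y + y') + u), (p (y - y') + v); split.
- by exists (y + y'), (z + z'), u; rewrite xyz xyz' addrACA.
- by exists (y - y'), (z - z'), v; rewrite xyz xyz' opprD addrACA.
by have := p_parallelogram y y'; rewrite rE rE'; lra.
Qed.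

Let Q_sub x y : Q (x + y) + Q (x - y) <= 2 * Q x + 2 * Q y.
Proof.
(* The infima are taken in turn: first over decompositions of [x], the cost [r] for [y] being
   fixed. *)
have step r : S y r -> (Q (x + y) + Q (x - y) - 2 * r) / 2 <= Q x.
  move=> Sr; apply: le_Q => r' Sr'.
  have [u [v [/Q_le Su /Q_le Sv uv]]] := S_parallelogram Sr' Sr; lra.
suff : (Q (x + y) + Q (x - y) - 2 * Q x) / 2 <= Q y by lra.
by apply: le_Q => r /step; lra.
Qed.

Let Q_double x : 4 * Q x <= Q (x + x).
Proof.
apply: le_Q => _ [y [z [s [xyz zs ->]]]].
suff : Q x <= 2^-1 ^+ 2 * p y + 2^-1 ^+ 2 * s by lra.
apply: Q_le; exists (2^-1%:C *: y), (2^-1%:C *: z), (2^-1 ^+ 2 * s); split.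
- rewrite -scalerDr -xyz scalerDr -scalerDl -rmorphD (_ : _ + _ = 1) ?scale1r //.
  by field.
- by rewrite sqZ weightZ ?zs // ?exprn_gt0 ?invr_gt0 //; exact: positive_sq.
by rewrite pZ.
Qed.

(** The reverse inequality is [Q_sub] at [x + y] and [x - y], whose sum and difference are [2 x] and
    [2 y], combined with [Q_double]. *)
Let Q_parallelogram x y : Q (x + y) + Q (x - y) = 2 * Q x + 2 * Q y.
Proof.
apply/eqP; rewrite eq_le Q_sub /=.
have := Q_sub (x + y) (x - y).
rewrite (_ : x + y + _ = x + x); last by rewrite addrACA subrr addr0.
rewrite (_ : x + y - _ = y + y); last by rewrite opprB [x + y]addrC addrACA subrr addr0.
have := Q_double x; have := Q_double y; lra.
Qed.

(** [T] maps decompositions of [x] to decompositions of [T x] of equal cost, the cost depending on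
    squares only. *)
Let Q_isometry (T : A -> A) : (forall x y, T (x + y) = T x + T y) ->
    (forall x, star (T x) * T x = star x * x) ->
  forall x, Q (T x) <= Q x.
Proof.
move=> TD Tsq x; apply: le_Q => _ [y [z [s [-> zs ->]]]].
by apply: Q_le; exists (T y), (T z), s; rewrite /p !Tsq TD.
Qed.

Let Qi x : Q ('i *: x) = Q x.
Proof.
have le y : Q ('i *: y) <= Q y.
  by apply: (Q_isometry (T := fun y => 'i *: y)) => *; rewrite ?scalerDr ?sqi.
apply/eqP; rewrite eq_le le /=.
(* As ['i ^+ 4 = 1], three more applications of the inequality lead from ['i *: x] back to [x]. *)
rewrite -[leLHS](congr1 Q (_ : 'i *: ('i *: ('i *: ('i *: x))) = x)).
  by do 3 apply: le_trans (le _) _.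
by rewrite !scaleiK opprK.
Qed.

Let Q_unitary U x : star U * U = 1 -> U * star U = 1 -> Q (U * x) = Q x.
Proof.
have le V y : star V * V = 1 -> Q (V * y) <= Q y.
  move=> V1; apply: (Q_isometry (T := fun y => V * y)) => *.
    by rewrite mulrDr.
  exact: sq_unitary.
move=> U1 U2; apply/eqP; rewrite eq_le le //=.
rewrite -[x in leLHS]mul1r -U1 -mulrA; apply: le; by rewrite starK.
Qed.

(** For the functional of [Q], the decomposition [x + 0] gives boundedness and [0 + x] the estimate
    by [tau0]. The lower bounds hold for each [y + z], since [psi1] and [psi2] lie below [tau0] on
    [z], and [k] times each lies below [p] on [y]. *)
Lemma parallel_sum : exists2 psi, minorant psi &
  forall a, positive_elt a ->
    (1 - eta) * complex.Re (psi1 a) <= complex.Re (psi a) /\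
    (1 - eta) * complex.Re (psi2 a) <= complex.Re (psi a).
Proof.
have [M1 M10 b1] := positive_functional_bounded min1.1.
have [M2 M20 b2] := positive_functional_bounded min2.1.
have K0 : 0 <= k * (M1 + M2) by rewrite mulr_ge0 ?addr_ge0.
have bnd x : 0 <= Q x <= k * (M1 + M2) * cnorm x ^+ 2.
  apply/andP; split; first by apply: le_Q => u; exact: S_ge0.
  apply: le_trans (Q_le (S_self x)) _; rewrite -mulrA; apply: ler_wpM2l => //.
  rewrite mulrDl -cstar_identity; apply: lerD.
    exact: le_trans (le_Re_normc _) (b1 _).
  exact: le_trans (le_Re_normc _) (b2 _).
have [psi pos psiQ] := quadratic_form_functional Q_parallelogram Qi Q_unitary K0 bnd.
exists psi.
  split=> // _ [x ->]; rewrite psiQ.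
  case E : (tau0 _) => [s| |]; last 2 first.
  - by rewrite leey.
  - by have := weight_ge0 htau (positive_sq x); rewrite E.
  rewrite lee_fin; apply: Q_le; exists 0, x, s; split; rewrite ?add0r //.
  by rewrite /p mulr0 !linear0 /= addr0 mulr0 add0r.
have low psi' x : minorant psi' ->
    (forall y, k * complex.Re (psi' (star y * y)) <= p y) ->
    (1 - eta) * complex.Re (psi' (star x * x)) <= complex.Re (psi (star x * x)).
  move=> [pos' le'] kp; rewrite psiQ; apply: le_Q => _ [y [z [s [-> zs ->]]]].
  have zs' : complex.Re (psi' (star z * z)) <= s.
    by rewrite -lee_fin -zs; apply: le'; exact: positive_sq.
  case/andP: eta01 => e0 e1.
  (* Expand [0 <= |(1 - eta) y - eta z|^2]. *)
  have := positive_functional_ge0 pos' (positive_sq ((1 - eta)%:C *: y - eta%:C *: z)).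
  rewrite sqB !sqZ sqD !starZr -!scalerAl -!scalerAr.
  have := kp y.
  rewrite !(Re_scalarD, Re_scalarN, Re_scalarB, Re_scalarZ).
  set u := complex.Re (psi' (star y * y)); set v := complex.Re _ in zs' *.
  set m1 := complex.Re _; set m2 := complex.Re _ => ky sq0.
  have ke : k * eta = 1 - eta by rewrite divfK // gt_eqF.
  (* By [k * eta = 1 - eta] the coefficient of [u] on the right is [(1 - eta) ^+ 2], as in the
     expanded square. *)
  have : eta * ((1 - eta) * (m1 + m2)) <= eta * (k * u - (1 - eta) * u + eta * v).
    have -> : eta * (k * u - (1 - eta) * u + eta * v) =
      k * eta * u - eta * (1 - eta) * u + eta ^+ 2 * v by ring.
    rewrite ke; lra.
  rewrite ler_pM2l //; lra.
move=> _ [x ->]; split; apply: low => // y; rewrite /p mulrDr.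
  by rewrite lerDl mulr_ge0 // (positive_functional_ge0 min2.1 (positive_sq y)).
by rewrite lerDr mulr_ge0 // (positive_functional_ge0 min1.1 (positive_sq y)).
Qed.

End ParallelSum.

End Minorants.

(** * Linear spans and subspaces *)

Section LinearSpan.
Variables (K : pzRingType) (V : lmodType K).
Implicit Types (S P : set V).

Lemma linear_span_subspace S : linear_subspace (linear_span S).
Proof.
split; first by exists 0%N, (fun=> 0), (fun=> 0); rewrite big_ord0; split => // -[].
move=> k x y [n [c [v [Sv ->]]]] [m [d [w [Sw ->]]]].
pose c' i := match fintype.split i with inl j => k * c j | inr j => d j end.
pose v' i := match @fintype.split n m i with inl j => v j | inr j => w j end.
exists (n + m)%N, c', v'; split.
  by move=> i; rewrite /v'; case: fintype.split.
rewrite big_split_ord scaler_sumr /=; congr (_ + _); apply: eq_bigr => i _.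
  by rewrite /c' /v' (unsplitK (inl i : 'I_n + 'I_m)) scalerA.
by rewrite /c' /v' (unsplitK (inr i : 'I_n + 'I_m)).
Qed.

Lemma sub_linear_span S : S `<=` linear_span S.
Proof.
move=> x Sx; exists 1%N, (fun=> 1), (fun=> x); split => //.
by rewrite big_ord1 scale1r.
Qed.

Lemma linear_span_min S P : linear_subspace P -> S `<=` P -> linear_span S `<=` P.
Proof.
move=> [P0 Plin] SP _ [n [c [v [Sv ->]]]].
elim/big_ind: _ => // [x y Px Py|i _]; first by rewrite -[x]scale1r; exact: Plin.
by rewrite -[_ *: _]addr0; apply: Plin => //; exact: SP.
Qed.

Lemma subspaceD P x y : linear_subspace P -> P x -> P y -> P (x + y).
Proof. by move=> [_ Plin] Px Py; rewrite -[x]scale1r; exact: Plin. Qed.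

Lemma subspaceZ P (k : K) x : linear_subspace P -> P x -> P (k *: x).
Proof. by move=> [P0 Plin] Px; rewrite -[_ *: _]addr0; exact: Plin. Qed.

Lemma subspaceB P x y : linear_subspace P -> P x -> P y -> P (x - y).
Proof.
by move=> Psub Px Py; apply: subspaceD => //; rewrite -scaleN1r; exact: subspaceZ.
Qed.

End LinearSpan.

(** * The regularization: additivity and linear extension *)

Section Regularization.
Variables (R : realType) (A : cstarAlgType R) (tau0 : A -> \bar R).
Implicit Types (x y z a b c : A) (t s : R) (psi : {scalar A}).
Hypothesis htau : is_weight tau0.

Local Notation minorant := (minorant tau0).
Local Notation tau := (regularization tau0).

(** The parallel sum serves when [tau0 0 = 0]; otherwise [tau0] is [+oo] on the positive cone and
    [psi1 + psi2] is a minorant. *)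
Lemma minorants_directed psi1 psi2 eta : minorant psi1 -> minorant psi2 ->
  0 < eta < 1 ->
  exists2 psi, minorant psi & forall a, positive_elt a ->
    (1 - eta) * complex.Re (psi1 a) <= complex.Re (psi a) /\
    (1 - eta) * complex.Re (psi2 a) <= complex.Re (psi a).
Proof.
move=> min1 min2 eta01; have [tau00|tauoo] := weight0 htau.
  exact: (parallel_sum htau tau00 min1 min2 eta01).
have [k x y|psi psiE] := @scalar_of _ A (fun x => psi1 x + psi2 x).
  by rewrite !linearP mulrDr addrACA.
have nneg psi' a : minorant psi' -> positive_elt a -> 0 <= complex.Re (psi' a).
  by move=> [+ _]; exact: positive_functional_ge0.
exists psi.
  split; last by move=> a pa; rewrite tauoo ?leey.
  split=> [|a pa]; last by rewrite psiE addr_ge0 ?min1.1.2 ?min2.1.2.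
  have [M1 _ b1] := positive_functional_bounded min1.1.
  have [M2 _ b2] := positive_functional_bounded min2.1.
  exists (M1 + M2) => a; rewrite psiE mulrDl.
  by apply: le_trans (le_normcD _ _) _; apply: lerD.
move=> a pa; rewrite psiE ReD; move: eta01 => /andP[e0 e1].
by have := nneg _ _ min1 pa; have := nneg _ _ min2 pa; split; nra.
Qed.

Lemma le_regularization psi a : minorant psi -> ((complex.Re (psi a))%:E <= tau a)%E.
Proof. by move=> mpsi; apply: ereal_sup_ubound; exists psi. Qed.

Lemma regularization_le a M :
  (forall psi, minorant psi -> ((complex.Re (psi a))%:E <= M)%E) -> (tau a <= M)%E.
Proof. by move=> aM; apply: ge_ereal_sup => _ [psi mpsi <-]; exact: aM. Qed.

(** Makes the supremum nonnegative, and stands in for one of two minorants when only the other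
    matters. *)
Lemma minorant0 : exists2 psi, minorant psi & forall a, psi a = 0.
Proof.
have [k x y|psi psiE] := @scalar_of _ A (fun=> 0); first by rewrite mulr0 addr0.
exists psi => //; split; last by move=> a pa; rewrite psiE weight_ge0.
by split=> [|a _]; [exists 0 => a; rewrite psiE mul0r Normc.normc0|rewrite psiE].
Qed.

Lemma regularization_ge0 a : (0 <= tau a)%E.
Proof.
by have [psi mpsi p0] := minorant0; have := le_regularization a mpsi; rewrite p0.
Qed.

Lemma regularization_fineK a : (tau a < +oo)%E -> tau a = (fine (tau a))%:E.
Proof. by move=> ta; rewrite fineK // ge0_fin_numE // regularization_ge0. Qed.

Lemma minorant_le_fine psi a : minorant psi -> (tau a < +oo)%E ->
  complex.Re (psi a) <= fine (tau a).
Proof.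
by move=> mpsi ta; rewrite -lee_fin -regularization_fineK // le_regularization.
Qed.

Lemma minorant_approx a e : (tau a < +oo)%E -> 0 < e ->
  exists2 psi, minorant psi & fine (tau a) - e <= complex.Re (psi a).
Proof.
move=> ta e0; have tafin : tau a \is a fin_num.
  by rewrite ge0_fin_numE // regularization_ge0.
have [_ [psi mpsi <-]] := ub_ereal_sup_adherent e0 tafin.
rewrite -/(tau a) (regularization_fineK ta) -EFinB lte_fin => /ltW lt.
by exists psi.
Qed.

(** Directedness replaces [psi1] and [psi2] by a single minorant at the price of a factor [1 - eta]
    arbitrarily close to [1]. *)
Lemma regularization_superadditive psi1 psi2 (l : R) a b : minorant psi1 ->
  minorant psi2 -> 0 <= l -> positive_elt a -> positive_elt b ->
  ((l * complex.Re (psi1 a) + complex.Re (psi2 b))%:E <= tau (l%:C *: a + b)%R)%E.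
Proof.
move=> m1 m2 l0 pa pb; have := regularization_ge0 (l%:C *: a + b).
case E : (tau _) => [r| |] //; last by move=> _; exact: leey.
rewrite !lee_fin => r0.
set w := _ + _.
have bound eta : 0 < eta < 1 -> (1 - eta) * w <= r.
  move=> eta01; have [psi mpsi psile] := minorants_directed m1 m2 eta01.
  have : complex.Re (psi (l%:C *: a + b)) <= r.
    by rewrite -lee_fin -E; exact: le_regularization.
  rewrite Re_scalarD Re_scalarZ /w mulrDr mulrCA; apply: le_trans.
  apply: lerD; last exact: (psile _ pb).2.
  by apply: ler_wpM2l => //; exact: (psile _ pa).1.
rewrite leNgt; apply/negP => rw; have w0 : 0 < w by lra.
(* With this [d], [(1 - d) * w] is the midpoint of [r] and [w], hence exceeds [r]. *)
pose d := (w - r) / (2 * w).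
have dw : d * w = (w - r) / 2 by rewrite /d; field; rewrite gt_eqF.
have d01 : 0 < d < 1.
  apply/andP; split; first by rewrite divr_gt0 ?mulr_gt0 // subr_gt0.
  by rewrite ltr_pdivrMr ?mulr_gt0 // mul1r; lra.
by have := bound d d01; rewrite mulrBl mul1r dw; lra.
Qed.

Lemma regularization_weight : is_weight tau.
Proof.
split=> [a _|l a b l0 pa pb]; first exact: regularization_ge0.
have [psi0 m0 psi0E] := minorant0.
apply/eqP; rewrite eq_le; apply/andP; split.
  apply: regularization_le => psi mpsi; rewrite Re_scalarD Re_scalarZ EFinD EFinM.
  apply: leeD; last exact: le_regularization.
  by apply: lee_wpmul2l; rewrite ?lee_fin ?(ltW l0) //; exact: le_regularization.
have := regularization_ge0 (l%:C *: a + b).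
case E : (tau _) => [r| |] //; last by move=> _; exact: leey.
rewrite lee_fin => r0.
have super psi1 psi2 : minorant psi1 -> minorant psi2 ->
    l * complex.Re (psi1 a) + complex.Re (psi2 b) <= r.
  move=> m1 m2; rewrite -lee_fin -E.
  exact: regularization_superadditive m1 m2 (ltW l0) pa pb.
(* A finite value at the combination forces finite values at [a] and [b]: the zero minorant is taken
   for the other term. *)
have ta : (tau a < +oo)%E.
  apply: (@le_lt_trans _ _ (r / l)%:E); last by rewrite ltry.
  apply: regularization_le => psi mpsi; rewrite lee_fin ler_pdivlMr // mulrC.
  by have := super _ _ mpsi m0; rewrite psi0E /= addr0.
have tb : (tau b < +oo)%E.
  apply: (@le_lt_trans _ _ r%:E); last by rewrite ltry.
  apply: regularization_le => psi mpsi; rewrite lee_fin.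
  by have := super _ _ m0 mpsi; rewrite psi0E /= mulr0 add0r.
rewrite (regularization_fineK ta) (regularization_fineK tb) -EFinM -EFinD lee_fin.
(* Errors [e / (l + 1)] at [a] and at [b], with weights [l] and [1], add up to [e]. *)
apply/ler_addgt0Pr => e e0; have l1 : 0 < l + 1 by rewrite addr_gt0.
have [psi1 m1 e1] := minorant_approx ta (divr_gt0 e0 l1).
have [psi2 m2 e2] := minorant_approx tb (divr_gt0 e0 l1).
have := super _ _ m1 m2.
have ee : e / (l + 1) * (l + 1) = e by rewrite divfK // gt_eqF.
by nra.
Qed.

(** Induction on the list: half of the error goes to the approximations, half to the factor lost in
    merging two minorants. *)
Lemma minorant_simultaneous_approx (s : seq A) e :
    (forall a, a \in s -> finite_part tau a) -> 0 < e ->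
  exists2 psi, minorant psi &
    forall a, a \in s -> fine (tau a) - e <= complex.Re (psi a).
Proof.
elim: s e => [|a s IHs] e fin e0.
  by have [psi mpsi _] := minorant0; exists psi.
have e2 : 0 < e / 2 by rewrite divr_gt0.
have [psi1 m1 p1] := IHs _ (fun b bs => fin b (mem_behead (s := a :: s) bs)) e2.
have [pa ta] := fin a (mem_head _ _).
have [psi2 m2 p2] := minorant_approx ta e2.
(* [B] dominates [tau] on the list, so the factor [1 - e / 2 / B] costs at most [e / 2]. *)
pose B := \sum_(b <- a :: s) fine (tau b) + e.
have fine_ge0 b : 0 <= fine (tau b) by rewrite fine_ge0 // regularization_ge0.
have leB b : b \in a :: s -> fine (tau b) + e <= B.
  move=> bs; rewrite lerD2r (big_rem b) //= lerDl; exact: sumr_ge0.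
have B0 : 0 < B by apply: lt_le_trans (leB a (mem_head _ _)); rewrite ltr_wpDl.
have [|psi mpsi psile] := @minorants_directed _ _ (e / 2 / B) m1 m2.
  rewrite divr_gt0 //= ltr_pdivrMr // mul1r.
  have := leB a (mem_head _ _); have := fine_ge0 a; lra.
have eB : e / 2 / B * B = e / 2 by rewrite divfK // gt_eqF.
have key psi' b : minorant psi' -> b \in a :: s ->
    fine (tau b) - e / 2 <= complex.Re (psi' b) ->
    (1 - e / 2 / B) * complex.Re (psi' b) <= complex.Re (psi b) ->
    fine (tau b) - e <= complex.Re (psi b).
  move=> m' bs; have [_ tb] := fin b bs; have := minorant_le_fine m' tb.
  have := leB _ bs; have := divr_gt0 e2 B0.
  move: (e / 2 / B) eB => d dB; nra.
exists psi => // b bs; have [pb _] := fin b bs; have [l1 l2] := psile _ pb.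
move: (bs); rewrite inE => /predU1P[ba|/p1 b1]; last exact: key m1 bs b1 l1.
by move: p2; rewrite -ba => p2; exact: key m2 bs p2 l2.
Qed.

(** The regular module [R[i]^o] makes the pairs a module, in which the graph has a linear span. *)
Let graph : set (A * R[i]^o) :=
  [set u | finite_part tau u.1 /\ u.2 = (fine (tau u.1))%:C].

(* One minorant approximates [tau] at all the [v i] simultaneously, and being
   linear it respects every relation between them. *)
Lemma finite_part_relation (w : R[i]) : linear_span graph (0, w) -> w = 0.
Proof.
move=> [n [c [v [gv vE]]]].
have v0 : \sum_(i < n) c i *: (v i).1 = 0.
  by have /(congr1 fst) := vE; rewrite raddf_sum.
have vw : w = \sum_(i < n) c i * (fine (tau (v i).1))%:C.
  have /(congr1 snd) := vE; rewrite raddf_sum /= => ->.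
  by apply: eq_bigr => i _; rewrite (gv i).2.
have bound e : 0 < e -> Normc.normc w <= (\sum_(i < n) Normc.normc (c i)) * e.
  move=> e0; have [|psi mpsi psile] :=
      @minorant_simultaneous_approx (map (fun i => (v i).1) (enum 'I_n)) e _ e0.
    by move=> _ /mapP[i _ ->]; exact: (gv i).1.
  have -> : w = \sum_(i < n) c i * (fine (tau (v i).1) - complex.Re (psi (v i).1))%:C.
    have psi0 : \sum_(i < n) c i * psi (v i).1 = 0.
      transitivity (psi (\sum_(i < n) c i *: (v i).1)); last by rewrite v0 linear0.
      by rewrite linear_sum; apply: eq_bigr => i _; rewrite linearZ.
    rewrite vw -[LHS]subr0 -[X in _ - X]psi0 -sumrB.
    apply: eq_bigr => i _; rewrite -mulrBr rmorphB /=.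
    by rewrite -(ge0_complexE (mpsi.1.2 _ (gv i).1.1)).
  rewrite mulr_suml.
  elim/big_ind2: _ => [|x y x' y' xy xy'|i _]; first by rewrite Normc.normc0.
    by apply: le_trans (le_normcD _ _) _; exact: lerD.
  rewrite Normc.normcM; apply: ler_wpM2l; first by case: (c i) => *; exact: sqrtr_ge0.
  rewrite normc_real ger0_norm; last first.
    by rewrite subr_ge0 minorant_le_fine //; exact: (gv i).1.2.
  by rewrite lerBlDr -lerBlDl; apply: psile; apply/mapP; exists i; rewrite ?mem_enum.
apply: Normc.eq0_normc; apply/eqP; rewrite eq_le; apply/andP; split; last first.
  by case: (w) => *; exact: sqrtr_ge0.
set C := \sum_(i < n) _ in bound.
have C0 : 0 <= C by apply: sumr_ge0 => i _; case: (c i) => *; exact: sqrtr_ge0.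
have C1 : 0 < C + 1 by rewrite ltr_wpDl.
apply/ler_addgt0Pr => e e0; rewrite add0r.
apply: le_trans (bound _ (divr_gt0 e0 C1)) _.
by rewrite mulrA ler_pdivrMr // mulrC ler_pM2l // lerDl.
Qed.

(** The span of [graph] is single-valued, since two values over one point differ by a value over
    [0]; it is thus the graph of a linear map. *)
Lemma linear_extension_exists : exists T : A -> R[i], linear_extension tau T.
Proof.
have [g0 glin] := linear_span_subspace graph.
have total z : finite_span tau z -> exists w, linear_span graph (z, w).
  apply: (@linear_span_min _ _ _ [set z | exists w, linear_span graph (z, w)]) =>
    [|a fa]; last first.
    by exists (fine (tau a))%:C; apply: sub_linear_span; split.
  split; first by exists 0.
  by move=> k x y [w gx] [w' gy]; exists (k * w + w'); exact: glin gx gy.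
have uniq z w w' : linear_span graph (z, w) -> linear_span graph (z, w') -> w = w'.
  move=> gw gw'; apply/eqP; rewrite -subr_eq0; apply/eqP/finite_part_relation.
  rewrite -[X in (X, _)](subrr z).
  exact: subspaceB (linear_span_subspace graph) gw gw'.
pose T z := xget 0 [set w | linear_span graph (z, w)].
have TE z w : linear_span graph (z, w) -> T z = w.
  move=> gw; apply: (uniq z) => //; rewrite /T.
  by apply: (@xgetPex _ 0 [set w | linear_span graph (z, w)]); exists w.
exists T; split.
  move=> k x y /total[w gw] /total[w' gw'].
  rewrite (TE _ _ gw) (TE _ _ gw'); apply: TE; exact: glin gw gw'.
by move=> a fa; apply: TE; apply: sub_linear_span; split.
Qed.

End Regularization.

(** * Unitary invariance, the ideal and the trace property *)

Section Trace.
Variables (R : realType) (A : cstarAlgType R) (A0 : set A) (tau0 : A -> \bar R).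
Implicit Types (x y z a b c U : A) (t s : R) (psi : {scalar A}).
Hypothesis hdense : dense (A0 : set (normed A)).
Hypothesis htau : is_weight tau0.
Hypothesis hinv : eps_invariant A0 tau0.

Local Notation minorant := (minorant tau0).
Local Notation tau := (regularization tau0).
Local Notation J := (finite_span tau).

(** A local Lipschitz estimate for conjugation, used to replace an element of [A] by a nearby one of
    [A0]. *)
Lemma cnorm_conj_sub x y a : cnorm (x - y) <= 1 ->
  cnorm (x * a * star x - y * a * star y) <=
    cnorm (x - y) * ((cnorm y *+ 2 + 1) * cnorm a).
Proof.
move=> xy1.
have -> : x * a * star x - y * a * star y =
    (x - y) * a * star x + y * a * star (x - y).
  by rewrite starB mulrBr !mulrBl addrA subrK.
have nx : cnorm x <= cnorm y + 1.
  have := cnormD (x - y) y; rewrite subrK; lra.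
apply: le_trans (cnormD _ _) _.
have M3 (u v w : A) : cnorm (u * v * w) <= cnorm u * cnorm v * cnorm w.
  apply: le_trans (cnormM _ _) _; apply: ler_wpM2r; first exact: cnorm_ge0.
  exact: cnormM.
have := M3 (x - y) a (star x); have := M3 y a (star (x - y)); rewrite !cnorm_star.
have : cnorm (x - y) * cnorm a * cnorm x <= cnorm (x - y) * cnorm a * (cnorm y + 1).
  by rewrite ler_wpM2l ?mulr_ge0 ?cnorm_ge0.
rewrite mulr2n; lra.
Qed.

(** For a minorant [psi], the functional [x |-> (1 + eps)^-1 psi (U x star U)] is again a minorant
    by the upper invariance bound. *)
Lemma regularization_quasi_invariant_dense eps : 0 < eps < 1 ->
  exists2 delta : R, 0 < delta &
  forall U a, delta_unitary A0 delta U -> positive_elt a ->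
    (tau (U * a * star U)%R <= (1 + eps)%:E * tau a)%E.
Proof.
move=> eps01; have [delta d0 inv] := hinv eps01; exists delta => // U a dU pa.
have e1 : 0 < 1 + eps by case/andP: eps01; lra.
apply: regularization_le => psi [pos le].
have [k x y|phi phiE] := @scalar_of _ A (fun x => (1 + eps)^-1%:C * psi (U * x * star U)).
  by rewrite mulrDr mulrDl -scalerAr -scalerAl linearP mulrDr mulrCA.
rewrite -lee_pdivrMl // -EFinM -ReZ -phiE.
apply: le_regularization; split; last first.
  move=> b pb; rewrite phiE ReZ EFinM lee_pdivrMl //.
  apply: le_trans (inv U b dU pb).2; exact/le/positive_conj.
split; last first.
  move=> b pb; rewrite phiE mulr_ge0 ?lecR ?invr_ge0 ?(ltW e1) //.
  exact/pos.2/positive_conj.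
have [M M0 pM] := positive_functional_bounded pos.
exists ((1 + eps)^-1 * (M * (cnorm U * cnorm U))) => b.
rewrite phiE Normc.normcM normc_real ger0_norm ?invr_ge0 ?(ltW e1) // -[leRHS]mulrA.
apply: ler_wpM2l; first by rewrite invr_ge0 ltW.
apply: le_trans (pM _) _; rewrite -[leRHS]mulrA; apply: ler_wpM2l => //.
apply: le_trans (cnormM _ _) _; rewrite cnorm_star [leRHS]mulrAC.
by apply: ler_wpM2r; [exact: cnorm_ge0|exact: cnormM].
Qed.

(** [U] is approximated by some [V] in [A0] with defects still below [delta], and each minorant is
    norm continuous. *)
Lemma regularization_quasi_invariant eps : 0 < eps < 1 ->
  exists2 delta : R, 0 < delta &
  forall U a, cnorm (star U * U - 1) < delta -> cnorm (U * star U - 1) < delta ->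
    positive_elt a -> (tau (U * a * star U)%R <= (1 + eps)%:E * tau a)%E.
Proof.
move=> eps01; have [delta d0 inv] := regularization_quasi_invariant_dense eps01.
have e1 : 0 < 1 + eps by case/andP: eps01; lra.
exists delta => // U a U1 U2 pa.
apply: regularization_le => psi mpsi.
have [->|taoo] := eqVneq (tau a) +oo%E; first by rewrite gt0_muley ?leey ?lte_fin.
have ta : (tau a < +oo)%E by rewrite lt_neqAle taoo leey.
rewrite (regularization_fineK htau ta) -EFinM lee_fin.
apply/ler_addgt0Pr => e e0.
have [M M0 pM] := positive_functional_bounded mpsi.1.
pose r1 := cnorm (star U * U - 1); pose r2 := cnorm (U * star U - 1).
(* [D] majorizes the constants of three errors: the two unitarity defects, where [1] is conjugated,
   and the value of [psi], where [a] is conjugated and the bound [M] enters. *)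
pose D := (cnorm U *+ 2 + 1) * (cnorm (1 : A) + cnorm a + 1) * (M + 1).
have nn := @cnorm_ge0 R A.
have D0 : 0 < D.
  rewrite /D mulr2n !mulr_gt0 //; have := nn U; have := nn 1; have := nn a; lra.
(* The gaps [delta - r1] and [delta - r2] keep [V] a [delta]-unitary; [e] is the error allowed for
   [psi]. *)
pose kappa := Num.min e (Num.min (delta - r1) (delta - r2)).
have kappa0 : 0 < kappa by rewrite !lt_min e0 !subr_gt0 U1.
pose eta := Num.min 1 (kappa / D).
have eta0 : 0 < eta by rewrite lt_min ltr01 divr_gt0.
have [V AV UV] := dense_approx hdense U eta0.
rewrite cnormC in UV.
have [VU1 VUk] : cnorm (V - U) <= 1 /\ cnorm (V - U) * D < kappa.
  by move: UV; rewrite lt_min => /andP[/ltW -> ]; rewrite ltr_pdivlMr.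
move: VUk; rewrite !lt_min => /andP[VUe /andP[VU2 VU3]].
have factor u q : 0 <= u -> u <= cnorm (1 : A) + cnorm a + 1 -> 0 <= q -> q <= M + 1 ->
    cnorm (V - U) * ((cnorm U *+ 2 + 1) * u) * q <= cnorm (V - U) * D.
  move=> u0 uD q0 qD; rewrite /D -!mulrA; apply: ler_wpM2l => //.
  apply: ler_wpM2l; first by rewrite mulr2n; have := nn U; lra.
  exact: ler_pM.
have dV : delta_unitary A0 delta V.
  split=> //.
  - have := cnorm_conj_sub (x := star V) (y := star U) 1.
    rewrite -starB !cnorm_star !starK !mulr1 => /(_ VU1) H.
    have := factor (cnorm (1 : A)) 1 (nn _); rewrite mulr1.
    have := cnormD (star V * V - star U * U) (star U * U - 1).
    rewrite addrA subrK -/r1 => n1.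
    have := nn a; have := nn 1 => n2 n3 F.
    have : cnorm (V - U) * ((cnorm U *+ 2 + 1) * cnorm (1 : A)) <= cnorm (V - U) * D.
      by apply: F; lra.
    lra.
  - have := cnorm_conj_sub (x := V) (y := U) 1.
    rewrite !mulr1 => /(_ VU1) H.
    have := factor (cnorm (1 : A)) 1 (nn _); rewrite mulr1.
    have := cnormD (V * star V - U * star U) (U * star U - 1).
    rewrite addrA subrK -/r2 => n1.
    have := nn a; have := nn 1 => n2 n3 F.
    have : cnorm (V - U) * ((cnorm U *+ 2 + 1) * cnorm (1 : A)) <= cnorm (V - U) * D.
      by apply: F; lra.
    lra.
have := le_trans (le_regularization _ mpsi) (inv V a dV pa).
rewrite [X in (_ * X)%E](regularization_fineK htau ta) -EFinM.
rewrite lee_fin => bV.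
have -> : U * a * star U = V * a * star V - (V * a * star V - U * a * star U).
  by rewrite opprB addrC subrK.
rewrite Re_scalarB.
have := le_Re_normc (psi (- (V * a * star V - U * a * star U))).
rewrite Re_scalarN => le1.
have := pM (- (V * a * star V - U * a * star U)); rewrite cnormN => le2.
have := factor (cnorm a) M (nn a) => F.
have : cnorm (V - U) * ((cnorm U *+ 2 + 1) * cnorm a) * M <= cnorm (V - U) * D.
  by apply: F => //; have := nn 1; lra.
have := cnorm_conj_sub a VU1 => /(ler_wpM2l M0).
lra.
Qed.

(** A unitary has zero defects, so the quasi-invariance bound holds for every [eps]. *)
Lemma regularization_unitary_le U a : star U * U = 1 -> U * star U = 1 ->
  positive_elt a -> (tau (U * a * star U)%R <= tau a)%E.
Proof.
move=> U1 U2 pa; have [->|taoo] := eqVneq (tau a) +oo%E; first by rewrite leey.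
have ta : (tau a < +oo)%E by rewrite lt_neqAle taoo leey.
apply: regularization_le => psi mpsi.
rewrite (regularization_fineK htau ta) lee_fin.
have pos : 0 <= fine (tau a) by rewrite fine_ge0 // regularization_ge0.
apply/ler_addgt0Pr => e e0.
(* This makes [eps * fine (tau a) <= e]; the cap [2^-1] keeps [eps < 1]. *)
pose eps := Num.min (2^-1) (e / (fine (tau a) + 1)).
have eps01 : 0 < eps < 1.
  rewrite lt_min divr_gt0 // ?ltr_wpDl // invr_gt0 ltr0n /= gt_min.
  by apply/orP; left; lra.
have [delta d0 inv] := regularization_quasi_invariant eps01.
have := inv U a; rewrite U1 U2 subrr cnorm0 => /(_ d0 d0 pa).
move=> /(le_trans (le_regularization _ mpsi)).
rewrite [X in (_ * X)%E](regularization_fineK htau ta) -EFinM.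
rewrite lee_fin => /le_trans; apply; rewrite mulrDl mul1r lerD2l.
have : eps * (fine (tau a) + 1) <= e.
  by rewrite -ler_pdivlMr ?ltr_wpDl // ge_min lexx orbT.
by apply: le_trans; apply: ler_wpM2l; [case/andP: eps01 => /ltW|rewrite lerDl].
Qed.

Lemma regularization_unitary U a : star U * U = 1 -> U * star U = 1 ->
  positive_elt a -> tau (U * a * star U) = tau a.
Proof.
move=> U1 U2 pa; apply/eqP; rewrite eq_le regularization_unitary_le //=.
have {1}-> : a = star U * (U * a * star U) * star (star U).
  by rewrite starK -!mulrA U1 mulr1 mulrA U1 mul1r.
apply: regularization_unitary_le; rewrite ?starK //; exact: positive_conj.
Qed.

Lemma regularization0 : tau 0 = 0%E.
Proof.
apply/eqP; rewrite eq_le regularization_ge0 // andbT.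
by apply: regularization_le => psi _; rewrite linear0.
Qed.

Let hreg : is_weight tau := regularization_weight htau.

(** The square-integrable elements for [tau]. *)
Let sqfin x := (tau (star x * x)%R < +oo)%E.

Lemma finite_partZ t a : 0 <= t -> finite_part tau a -> finite_part tau (t%:C *: a).
Proof.
rewrite le_eqVlt => /predU1P[<- _|t0 [pa ta]].
  rewrite scale0r; split; first exact: positive0.
  by rewrite regularization0 ltry.
split; first exact/positiveZ/pa/ltW.
by rewrite weightZ ?regularization0 // lte_mul_pinfty // lee_fin ltW.
Qed.

Let sqfin_finite x : sqfin x -> finite_part tau (star x * x).
Proof. by split=> //; exact: positive_sq. Qed.

Let sqfinZr t x : sqfin x -> sqfin (t%:C *: x).
Proof.
move=> fx; rewrite /sqfin sqZ.
exact: (finite_partZ (sqr_ge0 t) (sqfin_finite fx)).2.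
Qed.

Let sqfini x : sqfin x -> sqfin ('i *: x).
Proof. by rewrite /sqfin sqi. Qed.

(** By the parallelogram law the values at [x + y] and [x - y] have a finite sum, and both are
    nonnegative. *)
Let sqfinD x y : sqfin x -> sqfin y -> sqfin (x + y).
Proof.
move=> fx fy.
have := weightD hreg (positive_sq (x + y)) (positive_sq (x - y)).
rewrite sq_parallelogram.
have f2 z : sqfin z -> finite_part tau (2%:C *: (star z * z)).
  by move=> fz; apply: finite_partZ => //; exact: sqfin_finite.
have [p1 t1] := f2 _ fx; have [p2 t2] := f2 _ fy.
rewrite weightD // => E; rewrite /sqfin.
apply: (@le_lt_trans _ _
    (tau (star (x + y) * (x + y))%R + tau (star (x - y) * (x - y))%R)%E).
  by rewrite leeDl // regularization_ge0.
by rewrite -E lte_add_pinfty.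
Qed.

Let sqfinB x y : sqfin x -> sqfin y -> sqfin (x - y).
Proof.
move=> fx fy; apply: sqfinD => //; rewrite -scaleN1r.
by rewrite (_ : -1 = (-1)%:C); [exact: sqfinZr|rewrite rmorphN1].
Qed.

(** The square of [x * star U] is [star x * x] conjugated by the nearly unitary
    [U = 1 + t (star b)], and [x * b] is a multiple of [x * star U - x]. *)
Let sqfinM b x : sqfin x -> sqfin (x * b).
Proof.
move=> fx; have [|delta d0 inv] := @regularization_quasi_invariant 2^-1.
  by apply/andP; split; lra.
(* The defects of [U] are at most [2 eta + eta ^+ 2 <= 3 eta], which is below [4 eta <= delta]. *)
pose eta := Num.min 1 (delta / 4).
have eta0 : 0 < eta by rewrite lt_min ltr01 divr_gt0.
pose t := eta / (cnorm b + 1).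
have b0 := cnorm_ge0 b.
have b1 : 0 < cnorm b + 1 by lra.
have t0 : 0 < t by rewrite divr_gt0.
pose c := t%:C *: star b; pose U : A := 1 + c.
have cN : cnorm c <= eta.
  rewrite cnormZr cnorm_star ger0_norm ?(ltW t0) //.
  have <- : t * (cnorm b + 1) = eta by rewrite /t divfK // gt_eqF.
  by apply: ler_wpM2l; rewrite ?(ltW t0) // lerDl.
have [eta1 eta4] : eta <= 1 /\ eta * 4 <= delta.
  by split; [rewrite ge_min lexx|rewrite -ler_pdivlMr // ge_min lexx orbT].
have small (u v : A) : cnorm u <= eta -> cnorm v <= eta ->
    cnorm ((1 + u) * (1 + v) - 1) < delta.
  move=> ue ve.
  have -> : (1 + u) * (1 + v) - 1 = v + (u + u * v).
    by rewrite mulrDl mul1r mulrDr mulr1 addrAC [1 + v]addrC addrK.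
  have := cnormD v (u + u * v); have := cnormD u (u * v); have := cnormM u v.
  have := cnorm_ge0 u; have := cnorm_ge0 v => v0 u0.
  have : cnorm u * cnorm v <= eta * 1 by apply: ler_pM => //; lra.
  lra.
have sU : star U = 1 + star c by rewrite starD star1.
have U1 : cnorm (star U * U - 1) < delta by rewrite sU; apply: small; rewrite ?cnorm_star.
have U2 : cnorm (U * star U - 1) < delta by rewrite sU; apply: small; rewrite ?cnorm_star.
have fxU : sqfin (x * star U).
  rewrite /sqfin starM starK mulrA -(mulrA U).
  apply: le_lt_trans (inv U _ U1 U2 (positive_sq x)) _.
  by apply: lte_mul_pinfty; rewrite ?lee_fin.
have -> : x * b = t^-1%:C *: (x * star U - x).
  rewrite sU mulrDr mulr1 [x + _]addrC addrK /c starZr starK -scalerAr scalerA.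
  by rewrite -rmorphM mulVf ?gt_eqF // scale1r.
exact/sqfinZr/sqfinB.
Qed.

Let J_subspace : linear_subspace J := linear_span_subspace _.

Lemma finite_span_sq_mul x y : sqfin x -> sqfin y -> J (star y * x).
Proof.
move=> fx fy.
have Jsq z : sqfin z -> J (star z * z).
  by move=> fz; apply: sub_linear_span; exact: sqfin_finite.
have -> : star y * x = 4^-1%:C *: (4%:C *: (star y * x)).
  by rewrite scalerA -rmorphM mulVf ?scale1r // pnatr_eq0.
rewrite sq_polarization; apply: subspaceZ => //; apply: subspaceD => //.
  by apply: subspaceB => //; apply: Jsq; [exact: sqfinD|exact: sqfinB].
apply: subspaceZ => //; apply: subspaceB => //; apply: Jsq.
  exact/sqfinD/sqfini.
exact/sqfinB/sqfini.
Qed.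

(** On a generator, [b * (star y * y) = star (y * star b) * y] and
    [(star y * y) * b = star y * (y * b)], so stability under right multiplication serves both
    sides. *)
Lemma finite_span_ideal : two_sided_ideal J.
Proof.
split; first exact: J_subspace.
move=> b x.
have sub : linear_subspace [set x | J (b * x) /\ J (x * b)].
  split=> [|k y z /= [Jby Jyb] [Jbz Jzb]].
    by rewrite /= mulr0 mul0r; split; exact: J_subspace.1.
  by rewrite mulrDr mulrDl -scalerAr -scalerAl; split; apply: J_subspace.2.
apply: (linear_span_min sub) => _ [[y ->] fy] /=; split.
  rewrite mulrA -{1}(starK b) -starM; apply: finite_span_sq_mul => //.
  exact: sqfinM.
by rewrite -mulrA; apply: finite_span_sq_mul => //; exact: sqfinM.
Qed.

Lemma linear_extension_trace (T : A -> R[i]) : linear_extension tau T ->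
  forall a b, J a -> T (a * b) = T (b * a).
Proof.
move=> [Tlin Tfin].
have Jideal b x : J x -> J (b * x) /\ J (x * b) := finite_span_ideal.2 b x.
have J0 : J 0 := J_subspace.1.
have T0 : T 0 = 0.
  have := Tlin 1 0 0 J0 J0; rewrite scale1r addr0 mul1r => /eqP.
  by rewrite -subr_eq subrr => /eqP.
have TD x y : J x -> J y -> T (x + y) = T x + T y.
  by move=> Jx Jy; have := Tlin 1 x y Jx Jy; rewrite scale1r mul1r.
have TZ k x : J x -> T (k *: x) = k * T x.
  by move=> Jx; have := Tlin k x 0 Jx J0; rewrite addr0 T0 addr0.
have TN x : J x -> T (- x) = - T x.
  by move=> Jx; rewrite -scaleN1r TZ // mulN1r.
have Tconj U z : star U * U = 1 -> U * star U = 1 -> J z -> T (U * z * star U) = T z.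
  move=> U1 U2 Jz.
  (* Invariance is known on positive elements; the set where it holds is a subspace and so contains
     their span. *)
  have sub : linear_subspace [set z | J z /\ T (U * z * star U) = T z].
    split=> [|k x y [Jx Ex] [Jy Ey]]; first by rewrite /= mulr0 mul0r.
    have JU w : J w -> J (U * w * star U).
      by move=> Jw; apply: (Jideal _ _ _).2; exact: (Jideal _ _ Jw).1.
    split; first exact: J_subspace.2.
    by rewrite mulrDr mulrDl -scalerAr -scalerAl !Tlin ?Ex ?Ey //; exact: JU.
  apply: (linear_span_min sub _ Jz).2 => a fa; split; first exact: sub_linear_span.
  have tU := regularization_unitary U1 U2 fa.1.
  rewrite !Tfin ?tU //; split; first exact: positive_conj fa.1.
  by rewrite tU; exact: fa.2.
have Tskew b w : star b = - b -> cnorm b <= 2^-1 -> J w -> T (w * b) = T (b * w).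
  move=> sb b2 Jw; have [c [c1 c2 U1 U2]] := cayley_unitary sb b2.
  (* This [z] gives [c * z = w * (1 - b)] and [z * c = (1 - b) * w]. *)
  have [z zE] : exists z, z = (1 - b) * w * (1 - b) by eexists.
  have Jz : J z by rewrite zE; apply: (Jideal _ _ _).2; exact: (Jideal _ _ Jw).1.
  (* Conjugating [z * U] by [U = 2 c - 1] yields [U * z], so [T (U * z) = T (z * U)], where the
     terms [T z] cancel. *)
  have := Tconj _ (z * (c *+ 2 - 1)) U1 U2 (Jideal _ _ Jz).2.
  have [Jcz Jzc] := Jideal c _ Jz.
  rewrite -!mulrA U2 mulr1 mulrBl mulrBr mul1r mulr1 !mulrnAl !mulrnAr !mulr2n.
  rewrite !TD ?TN //; try exact: subspaceD;
    try by rewrite -scaleN1r; apply: subspaceZ.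
  have -> : z * c = (1 - b) * w by rewrite zE -(mulrA _ _ c) c2 mulr1.
  have -> : c * z = w * (1 - b) by rewrite zE !mulrA c1 mul1r.
  have [Jbw Jwb] := Jideal b _ Jw.
  rewrite mulrBl mulrBr mul1r mulr1 !TD ?TN //;
    try by rewrite -scaleN1r; apply: subspaceZ.
  move=> /addIr/eqP; rewrite -!mulr2n -subr_eq0 -mulrnBl mulrn_eq0 /= subr_eq0.
  by move=> /eqP/addrI/oppr_inj.
(* Linearity extends the small skew-adjoint case to every [b]. *)
move=> a b Ja; have [t [k1 [k2 [s1 s2 n1 n2 ->]]]] := skew_decomposition b.
rewrite -scalerAr -scalerAl !mulrDr !mulrDl -scalerAr -scalerAl.
have [J1 J1'] := Jideal k1 _ Ja; have [J2 J2'] := Jideal k2 _ Ja.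
have Tcomb x y : J x -> J y -> T (t%:C *: (x + 'i *: y)) = t%:C * (T x + 'i * T y).
  move=> Jx Jy; have Jiy : J ('i *: y) by exact: subspaceZ.
  by rewrite TZ; [rewrite TD // (TZ _ y)|exact: subspaceD].
by rewrite (Tcomb _ _ J1' J2') (Tcomb _ _ J1 J2) (Tskew k1) // (Tskew k2).
Qed.

End Trace.

Theorem proposition1p25 (R : realType) (A : cstarAlgType R) (A0 : set A)
    (tau0 : A -> \bar R) (hA0 : star_subalgebra A0) (hdense : dense (A0 : set (normed A)))
    (hweight : is_weight tau0) (hinv : eps_invariant A0 tau0) :
  let tau := regularization tau0 in
  let J := finite_span tau in
  [/\ is_weight tau,
      two_sided_ideal J,
      exists T : A -> R[i], linear_extension tau T
    & forall T : A -> R[i], linear_extension tau T ->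
        forall a b : A, J a -> T (a * b) = T (b * a)].
Proof.
split.
- exact: regularization_weight.
- exact: finite_span_ideal hdense hweight hinv.
- exact: linear_extension_exists.
- exact: linear_extension_trace hdense hweight hinv.
Qed.
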